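(* Let $L$ be a countable metric signature and let $U:\mathcal M(L)\to\mathbb R$ be a bounded Borel function on the space of separable $L$-structures that is invariant under isomorphism. Then there exists an $\mathcal L_{\omega_1\omega}(L)$-sentence $\phi$ such that $U(A)=\phi^A$ for every $A\in\mathcal M(L)$.
   Context: Moduli. For $n\in\mathbb N$ or $n=\mathbb N$, an $n$-ary modulus is a continuous function $\Delta:[0,\infty)^n\to[0,\infty)$ with $\Delta(0)=0$ and $\Delta(\delta)\le\Delta(\delta+\delta')\le\Delta(\delta)+\Delta(\delta')$. A map $f$ from a product of metric spaces $\prod_{i<n}X_i$ to a metric space respects $\Delta$ if $d(f(x),f(y))\le\Delta((d(x_i,y_i))_{i<n})$ for all $x,y$. Signatures and structures. A metric signature $L$ is a set of function and predicate symbols; each symbol $s$ has an arity $n_s$ and an $n_s$-ary modulus $\Delta_s$, and each predicate symbol $P$ also has a compact interval $I_P\subseteq\mathbb R$ (its bound). $L$ always contains a binary predicate symbol $d$ with $\Delta_d(\delta_1,\delta_2)=\delta_1+\delta_2$ and some bound. An $L$-structure $A$ is a complete metric space with maps $F^A:A^{n_F}\to A$ respecting $\Delta_F$ and functions $P^A:A^{n_P}\to I_P$ respecting $\Delta_P$, where $d$ is interpreted as the distance. Isomorphisms are bijections preserving all symbols (including $d$). Formulas. Variables are $x_0,x_1,\dots$. Terms and formulas carry moduli, formulas also carry bounds: $\Delta_{x_i}(\delta)=\delta_i$; $\Delta_{F(\bar\tau)}=\Delta_F\circ(\Delta_{\tau_i})_i$; an atomic formula $P(\bar\tau)$ has modulus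 $\Delta_P\circ(\Delta_{\tau_i})_i$ and bound $I_P$. If $f:\prod_i I_{\phi_i}\to\mathbb R$ is continuous, $f(\phi_0,\dots,\phi_{m-1})$ has modulus $\Delta_f\circ(\Delta_{\phi_i})_i$ and bound $f(\prod_i I_{\phi_i})$, where $\Delta_f(\delta)=\sup\{|f(x)-f(y)|:|x_i-y_i|\le\delta_i\}$. $\mathcal L_{\omega_1\omega}(L)$-formulas are built from atomic formulas by such continuous connectives, by $\sup_{x_i}$ and $\inf_{x_i}$ (same bound; $\delta_i$ replaced by $0$ in the modulus), and by countable $\bigvee_i\phi_i,\bigwedge_i\phi_i$ (interpreted as $\sup_i,\inf_i$), allowed when all $\phi_i$ respect a common modulus and a common bound, which the result then respects. (A formula with modulus $\Delta$ and bound $I$ respects any $\Delta'\ge\Delta$, $I'\supseteq I$.) $\phi^A$ is the interpretation of $\phi$ in $A$; a sentence has no free variables. The space $\mathcal M(L)$ ($L$ countable). Replace each $n$-ary function symbol $F$ by an $(n+1)$-ary predicate $D_F(\bar x,y)=d(F(\bar x),y)$ with modulus $\Delta_F(\delta)+\delta'$ and the bound of $d$, and enumerate the resulting predicates as $d=P_0,P_1,\dots$ with arities $n_0,n_1,\dots$. A sequence $(a_i)_{i\in\mathbb N}$ in $A$ is tail-dense if $\{a_i:i>k\}$ is dense in $A$ for every $k$. $\mathcal M(L)$ is the set of $p\in\prod_i\mathbb R^{\mathbb N^{n_i}}$ for which there are a separable $L$-structure $A$ and a tail-dense sequence $(a_i)$ in $A$ with $p(i)(j_0,\dots,j_{n_i-1})=P_i^A(a_{j_0},\dots,a_{j_{n_i-1}})$.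 With the product topology it is a Polish space. An element is identified with the corresponding structure. *)

(* Defs.v *)
From HB Require Import structures.
From mathcomp Require Import all_boot all_order all_algebra.
From mathcomp Require Import all_classical all_reals all_analysis.

Set Implicit Arguments.
Unset Strict Implicit.
Unset Printing Implicit Defensive.

Import Order.TTheory GRing.Theory Num.Theory.
Import numFieldNormedType.Exports.

Local Open Scope classical_set_scope.
Local Open Scope ring_scope.

(* A function on the orthant [0,oo)^I is represented by a function on R^I,
   whose values outside the orthant are irrelevant. *)
Definition orthant (R : realType) (I : Type) : set {ptws I -> R} :=
  [set delta | forall i, 0 <= delta i].
Arguments orthant R I _ : clear implicits.

Record modulus (R : realType) (I : Type) := Modulus {
  modulus_fun :> {ptws I -> R} -> R;
  modulus_ge0 : forall delta, orthant R I delta -> 0 <= modulus_fun delta;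
  modulus_continuous : {within orthant R I, continuous modulus_fun};
  modulus0 : modulus_fun (fun=> 0) = 0;
  modulus_le : forall delta delta', orthant R I delta -> orthant R I delta' ->
    modulus_fun delta <= modulus_fun (fun i => delta i + delta' i);
  modulusD : forall delta delta', orthant R I delta -> orthant R I delta' ->
    modulus_fun (fun i => delta i + delta' i)
      <= modulus_fun delta + modulus_fun delta' }.

Definition respects (R : realType) (I : Type) (X Y : metricType R)
    (Delta : (I -> R) -> R) (f : (I -> X) -> Y) : Prop :=
  forall x y, mdist (f x) (f y) <= Delta (fun i => mdist (x i) (y i)).

Definition is_bound (R : realType) (J : set R) : Prop :=
  exists a b : R, a <= b /\ J = [set` `[a, b]].

(* The mandatory symbol d is kept apart from the other predicate symbols;
   see [predicate] for the full set of predicate symbols. *)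
Record signature (R : realType) := Signature {
  func : choiceType;
  func_arity : func -> nat;
  func_modulus : forall F, modulus R 'I_(func_arity F);
  rel : choiceType;
  rel_arity : rel -> nat;
  rel_modulus : forall P, modulus R 'I_(rel_arity P);
  rel_bound : rel -> set R;
  rel_boundP : forall P, is_bound (rel_bound P);
  d_bound : set R;
  d_boundP : is_bound d_bound }.
Arguments func_arity {R L} F : rename.
Arguments func_modulus {R L} F : rename.
Arguments rel_arity {R L} P : rename.
Arguments rel_modulus {R L} P : rename.
Arguments rel_bound {R L} P : rename.
Arguments rel_boundP {R L} P : rename.

Definition countable_signature (R : realType) (L : signature R) : Prop :=
  countable [set: func L] /\ countable [set: rel L].

(* [None] is the symbol d. *)
Definition predicate (R : realType) (L : signature R) := option (rel L).

Definition pred_arity (R : realType) (L : signature R) (P : predicate L) : nat :=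
  if P is Some r then rel_arity r else 2%N.

Definition pred_modulus (R : realType) (L : signature R) (P : predicate L) :
    ('I_(pred_arity P) -> R) -> R :=
  match P return ('I_(pred_arity P) -> R) -> R with
  | Some r => rel_modulus r
  | None => fun delta : 'I_2 -> R => delta ord0 + delta ord_max
  end.

Definition pred_bound (R : realType) (L : signature R) (P : predicate L) : set R :=
  if P is Some r then rel_bound r else d_bound L.

(* The carrier may be empty.  Completeness is stated with filters as in
   [completeType], which cannot be used because it requires a point. *)
Record structure (R : realType) (L : signature R) := Structure {
  carrier :> metricType R;
  carrier_complete : forall F : set_system carrier,
    ProperFilter F -> cauchy F -> exists x : carrier, F --> x;
  func_interp : forall F : func L, ('I_(func_arity F) -> carrier) -> carrier;
  func_respects : forall F, respects (func_modulus F) (@func_interp F);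
  rel_interp : forall P : rel L, ('I_(rel_arity P) -> carrier) -> R;
  rel_respects : forall P,
    respects (rel_modulus P) (@rel_interp P : _ -> R^o);
  rel_bounded : forall P x, rel_bound P (@rel_interp P x);
  d_bounded : forall x y : carrier, d_bound L (mdist x y) }.
Arguments func_interp {R L} A F x : rename.
Arguments rel_interp {R L} A P x : rename.

Definition pred_interp (R : realType) (L : signature R) (A : structure L)
    (P : predicate L) : ('I_(pred_arity P) -> A) -> R :=
  match P return ('I_(pred_arity P) -> A) -> R with
  | Some r => rel_interp A r
  | None => fun x : 'I_2 -> A => mdist (x ord0) (x ord_max)
  end.
Arguments pred_interp {R L} A P x.

Definition isomorphic (R : realType) (L : signature R) (A B : structure L) : Prop :=
  exists h : A -> B, [/\ bijective h,
    forall (F : func L) x, h (func_interp A F x) = func_interp B F (h \o x) &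
    forall (P : predicate L) x, pred_interp B P (h \o x) = pred_interp A P x].

Inductive term (R : realType) (L : signature R) : Type :=
| Var of nat
| App (F : func L) of 'I_(func_arity F) -> term L.
Arguments Var {R L} i : rename.
Arguments App {R L} F ts : rename.

Fixpoint term_modulus (R : realType) (L : signature R) (t : term L)
    (delta : nat -> R) : R :=
  match t with
  | Var i => delta i
  | App F ts => func_modulus F (fun i => term_modulus (ts i) delta)
  end.

Fixpoint term_fv (R : realType) (L : signature R) (t : term L) : set nat :=
  match t with
  | Var i => [set i]
  | App F ts => \bigcup_i term_fv (ts i)
  end.

Fixpoint term_value (R : realType) (L : signature R) (A : structure L)
    (t : term L) (v : nat -> A) : A :=
  match t with
  | Var i => v i
  | App F ts => func_interp A F (fun i => term_value (ts i) v)
  end.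

(* Raw formulas; the side conditions are in [wf].  [BigSup Delta J phis] is the
   countable disjunction of the [phis k], carrying the chosen common modulus
   [Delta] and common bound [J]; likewise [BigInf]. *)
Inductive formula (R : realType) (L : signature R) : Type :=
| Atom (P : predicate L) of 'I_(pred_arity P) -> term L
| Conn (m : nat) of ({ptws 'I_m -> R} -> R) & ('I_m -> formula L)
| Sup of nat & formula L
| Inf of nat & formula L
| BigSup of modulus R nat & set R & (nat -> formula L)
| BigInf of modulus R nat & set R & (nat -> formula L).
Arguments Atom {R L} P ts : rename.
Arguments Conn {R L} m f phis : rename.
Arguments Sup {R L} i phi : rename.
Arguments Inf {R L} i phi : rename.
Arguments BigSup {R L} Delta J phis : rename.
Arguments BigInf {R L} Delta J phis : rename.

Definition box (R : realType) (m : nat) (J : 'I_m -> set R) :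
  set {ptws 'I_m -> R} := [set x | forall i, J i (x i)].

Definition conn_modulus (R : realType) (m : nat) (J : 'I_m -> set R)
    (f : {ptws 'I_m -> R} -> R) (delta : 'I_m -> R) : R :=
  sup [set r | exists x y, [/\ box J x, box J y,
    forall i, `|x i - y i| <= delta i & r = `|f x - f y|]].

Fixpoint bound (R : realType) (L : signature R) (phi : formula L) : set R :=
  match phi with
  | Atom P _ => pred_bound P
  | Conn m f phis => f @` box (fun i => bound (phis i))
  | Sup _ phi | Inf _ phi => bound phi
  | BigSup _ J _ | BigInf _ J _ => J
  end.

Fixpoint formula_modulus (R : realType) (L : signature R) (phi : formula L)
    (delta : nat -> R) : R :=
  match phi with
  | Atom P ts => pred_modulus (fun i => term_modulus (ts i) delta)
  | Conn m f phis => conn_modulus (fun i => bound (phis i)) f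
      (fun i => formula_modulus (phis i) delta)
  | Sup i phi | Inf i phi => formula_modulus phi [eta delta with i |-> 0]
  | BigSup Delta _ _ | BigInf Delta _ _ => Delta delta
  end.

Definition formula_respects (R : realType) (L : signature R)
    (Delta : modulus R nat) (J : set R) (phi : formula L) : Prop :=
  (forall delta, orthant R nat delta -> formula_modulus phi delta <= Delta delta) /\
  bound phi `<=` J.

Fixpoint wf (R : realType) (L : signature R) (phi : formula L) : Prop :=
  match phi with
  | Atom _ _ => True
  | Conn m f phis => (forall i, wf (phis i)) /\
      {within box (fun i => bound (phis i)), continuous f}
  | Sup _ phi | Inf _ phi => wf phi
  | BigSup Delta J phis | BigInf Delta J phis =>
      [/\ is_bound J, forall k, wf (phis k) &
          forall k, formula_respects Delta J (phis k)]
  end.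

Fixpoint formula_fv (R : realType) (L : signature R) (phi : formula L) : set nat :=
  match phi with
  | Atom P ts => \bigcup_i term_fv (ts i)
  | Conn m f phis => \bigcup_i formula_fv (phis i)
  | Sup i phi | Inf i phi => formula_fv phi `\ i
  | BigSup _ _ phis | BigInf _ _ phis => \bigcup_k formula_fv (phis k)
  end.

Definition sentence (R : realType) (L : signature R) (phi : formula L) : Prop :=
  wf phi /\ formula_fv phi = set0.

Fixpoint value (R : realType) (L : signature R) (A : structure L)
    (phi : formula L) (v : nat -> A) : R :=
  match phi with
  | Atom P ts => pred_interp A P (fun i => term_value (ts i) v)
  | Conn m f phis => f (fun i => value (phis i) v)
  | Sup i phi => sup (range (fun a : A => value phi [eta v with i |-> a]))
  | Inf i phi => inf (range (fun a : A => value phi [eta v with i |-> a]))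
  | BigSup _ _ phis => sup (range (fun k => value (phis k) v))
  | BigInf _ _ phis => inf (range (fun k => value (phis k) v))
  end.

Definition separable (R : realType) (A : metricType R) : Prop :=
  exists D : set A, countable D /\ dense D.

Definition tail_dense (R : realType) (A : metricType R) (a : nat -> A) : Prop :=
  forall k, dense [set a i | i in [set i | (k < i)%N]].

(* The predicate symbols left after each function symbol F, here [inr F], is
   replaced by its graph predicate D_F(x,y) = d(F(x),y). *)
Definition graph_predicate (R : realType) (L : signature R) : Type :=
  (predicate L + func L)%type.

Definition graph_arity (R : realType) (L : signature R)
    (s : graph_predicate L) : nat :=
  match s with inl P => pred_arity P | inr F => (func_arity F).+1 end.

Definition graph_interp (R : realType) (L : signature R) (A : structure L)
    (s : graph_predicate L) : ('I_(graph_arity s) -> A) -> R :=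
  match s return ('I_(graph_arity s) -> A) -> R with
  | inl P => pred_interp A P
  | inr F => fun x : 'I_(func_arity F).+1 -> A =>
      mdist (func_interp A F (fun i => x (widen_ord (leqnSn _) i))) (x ord_max)
  end.
Arguments graph_interp {R L} A s x.

(* The factors are indexed by the symbols themselves, not by an enumeration. *)
Definition code_space (R : realType) (L : signature R) :=
  prod_topology (fun s : graph_predicate L =>
    {ptws ('I_(graph_arity s) -> nat) -> R}).

(* p is a point of [code_space] corresponding to the structure A. *)
Definition codes (R : realType) (L : signature R) (p : code_space L)
    (A : structure L) : Prop :=
  separable A /\ exists a : nat -> A, tail_dense a /\
    forall (s : graph_predicate L) (j : 'I_(graph_arity s) -> nat),
      p s j = graph_interp A s (a \o j).

Definition structure_space (R : realType) (L : signature R) : set (code_space L) :=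
  [set p | exists A : structure L, codes p A].
Arguments structure_space {R} L _.

Definition borel_fun (R : realType) (T : topologicalType) (f : T -> R) : Prop :=
  forall B : set R, measurable B -> <<s @open T >> (f @^-1` B).

Definition iso_invariant (R : realType) (L : signature R)
    (U : structure_space L -> R) : Prop :=
  forall (p q : structure_space L) (A B : structure L),
    codes (\val p) A -> codes (\val q) B -> isomorphic A B -> U p = U q.

(* Main.v *)
Require Import Defs.
From mathcomp Require Import all_boot all_order all_algebra.
From mathcomp Require Import all_classical all_reals all_analysis.
From mathcomp Require Import lra.
Import Order.TTheory GRing.Theory Num.Theory.
Import numFieldNormedType.Exports.
Local Open Scope classical_set_scope.
Local Open Scope ring_scope.

Set Implicit Arguments.
Unset Strict Implicit.
Unset Printing Implicit Defensive.

(** Fix a structure A and give the set of sequences y in A the product topology.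
  For an open W, consider the functions min(1, inf_{y in W} K sum_{k<m} d(v_{s+k}, y_k))
  of an assignment v.  A Borel set B of codes is called definable if these are
  the values of formulas, which do not depend on A, for some open W that agrees
  with the set of y whose code is in B up to a meager set.
  - For countable unions, take the union of the W's and the infimum of the formulas.
  - For the complement, take the exterior of W, since the boundary of W is meager.
    A point z is in the exterior iff one of the distances to W is positive at z;
    the formula is an infimum over finite tuples z of 1 minus that distance at z
    plus K sum d(v_k, z_k).
  - For a cylinder, W is the cylinder itself, and the distance to it is
    an infimum over finite tuples.
  Hence all Borel sets are definable.  A generic y is tail-dense, so for an invariant
  B the Baire category theorem makes W nonempty iff
  A is in B: the formula with m = K = 0 has value 0 if A is in B, and 1 otherwise.
  Finally U is the supremum of the functions equal to q where U > q and to the lower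
  bound of U elsewhere, for q rational. *)

(** * Baire category in spaces of sequences *)

Section SequenceSpace.
Context {R : realType} {X : metricType R}.
Implicit Types (y z w : nat -> X) (W D S : set (nat -> X)) (n N : nat).

Definition dyadic n : R := 2^-1 ^+ n.

Lemma dyadic_gt0 n : 0 < dyadic n.
Proof. by rewrite exprn_gt0// invr_gt0. Qed.

Lemma dyadic_le n N : (n <= N)%N -> dyadic N <= dyadic n.
Proof. by move=> nN; rewrite ler_wiXn2l// ?invr_ge0// invf_le1// ler1n. Qed.

Lemma dyadic_lt n : dyadic n.+1 < dyadic n.
Proof.
by rewrite /dyadic exprS gtr_pMl ?dyadic_gt0// invf_lt1// ltr1n.
Qed.

Lemma dyadic_lt_eps (e : R) : 0 < e -> exists n, dyadic n < e.
Proof.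
move=> e0; have /cvgrPdist_lt/(_ _ e0) : dyadic n @[n --> \oo] --> (0 : R^o).
  by apply: cvg_expr; rewrite gtr0_norm ?invr_gt0// invf_lt1// ltr1n.
move=> [n _ /(_ n (leqnn n))]; rewrite sub0r normrN.
by rewrite gtr0_norm ?dyadic_gt0//; exists n.
Qed.

(** These sets form a neighbourhood base of y in the product topology; the one index n limits both
    the coordinates that are constrained and the radius. *)
Definition near_seq n y z := forall i, (i < n)%N -> mdist (y i) (z i) < dyadic n.

Definition open_seq W :=
  forall y, W y -> exists n, forall z, near_seq n y z -> W z.

Definition dense_seq D := forall y n, exists2 z, D z & near_seq n y z.

Definition comeager S := exists D : nat -> set (nat -> X),
  (forall k, open_seq (D k) /\ dense_seq (D k)) /\
  forall y, (forall k, D k y) -> S y.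

Lemma near_seq_refl n y : near_seq n y y.
Proof. by move=> i _; rewrite mdistxx dyadic_gt0. Qed.
Arguments near_seq_refl : clear implicits.

Lemma near_seq_le n N y z : (n <= N)%N -> near_seq N y z -> near_seq n y z.
Proof.
move=> nN h i ilt; apply: lt_le_trans (dyadic_le nN).
exact/h/(leq_trans ilt).
Qed.

Lemma uniform_index (P : nat -> nat -> Prop) m :
    (forall i n N, (n <= N)%N -> P i n -> P i N) ->
    (forall i, (i < m)%N -> exists n, P i n) ->
  exists n, forall i, (i < m)%N -> P i n.
Proof.
move=> Pmono; elim: m => [|m IH] Pm; first by exists 0%N.
have [i /(ltn_trans)/(_ (ltnSn m))/Pm//|n nP] := IH.
have [N NP] := Pm _ (ltnSn m).
exists (maxn n N) => i; rewrite ltnS leq_eqVlt => /predU1P[->|im].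
  exact: Pmono (leq_maxr _ _) NP.
exact: Pmono (leq_maxl _ _) (nP _ im).
Qed.

Lemma open_seqI W D : open_seq W -> open_seq D -> open_seq (W `&` D).
Proof.
move=> Wo Do y [/Wo[n nW] /Do[N ND]]; exists (maxn n N) => z h; split.
  exact/nW/near_seq_le/h/leq_maxl.
exact/ND/near_seq_le/h/leq_maxr.
Qed.

Lemma open_near_seq n y : open_seq [set z | near_seq n y z].
Proof.
move=> z yz.
pose P i N := forall w, near_seq N z w -> mdist (y i) (w i) < dyadic n.
have [|i im|N NP] := @uniform_index P n.
- move=> i N N' NN' h w zw; exact/h/near_seq_le/zw.
- have e0 : 0 < dyadic n - mdist (y i) (z i) by rewrite subr_gt0 yz.
  have [N rN] := dyadic_lt_eps e0.
  (* The dyadic radius of index N fits in the margin left at coordinate i; the index must also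
     exceed i for that coordinate to be constrained. *)
  exists (maxn N i.+1) => w zw.
  apply: le_lt_trans (metric_triangle _ (z i) _) _.
  rewrite -ltrBrDl; apply: lt_trans rN.
  apply: lt_le_trans (zw _ _) (dyadic_le _) => //; first by rewrite leq_max ltnSn orbT.
  exact: leq_maxl.
- by exists N => w zw i im; apply: NP.
Qed.

Arguments open_near_seq : clear implicits.

Lemma comeagerI S S' : comeager S -> comeager S' -> comeager (S `&` S').
Proof.
move=> [D [Dod DS]] [D' [D'od D'S]].
exists (fun k => if odd k then D k./2 else D' k./2); split.
  by move=> k; case: ifP.
move=> y yD; split.
- by apply: DS => k; have := yD k.*2.+1; rewrite /= odd_double uphalf_double.
- by apply: D'S => k; have := yD k.*2; rewrite odd_double doubleK.
Qed.

Lemma comeager_bigcap (S : nat -> set (nat -> X)) :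
  (forall i, comeager (S i)) -> comeager (\bigcap_i S i).
Proof.
move=> /choice[D /all_and2[Dod DS]].
(* Pairs (i, j) are listed as one sequence; numbers that code no pair get the whole space, which is
   open and dense. *)
exists (fun k => if unpickle k is Some (i, j) then D i j else setT); split.
  move=> k; case: unpickle => [[i j]|]; first exact: Dod.
  split; first by move=> y _; exists 0%N.
  by move=> y n; exists y => //; exact: near_seq_refl.
move=> y yD i _; apply: DS => j.
by have := yD (pickle (i, j)); rewrite pickleK.
Qed.

Lemma sub_comeager S S' : S `<=` S' -> comeager S -> comeager S'.
Proof. by move=> SS' [D [? DS]]; exists D; split=> // y /DS/SS'. Qed.

Definition exterior_seq W : set (nat -> X) :=
  [set y | exists n, forall z, near_seq n y z -> ~ W z].

Lemma open_exterior_seq W : open_seq (exterior_seq W).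
Proof.
move=> y [n nW]; have [N h] := open_near_seq n y _ (near_seq_refl n y).
by exists N => z /h yz; have [M k] := open_near_seq _ _ _ yz; exists M => w /k/nW.
Qed.

(** The union of an open set and its exterior is open and dense, and at its points not being in W
    means being in the exterior. *)
Lemma comeager_exterior_seq W :
  open_seq W -> comeager [set y | exterior_seq W y <-> ~ W y].
Proof.
move=> Wo; exists (fun=> W `|` exterior_seq W); split.
  move=> _; split.
    move=> y [/Wo[n nW]|/open_exterior_seq[n nW]]; exists n => z /nW; [by left|by right].
  move=> y n; have [[z [yz Wz]]|/forallNP h] := pselect (exists z, near_seq n y z /\ W z).
    by exists z => //; left.
  exists y; last exact: near_seq_refl.
  by right; exists n => z yz Wz; exact: (h z).
move=> y /(_ 0%N) Wy; split=> [[n /(_ _ (near_seq_refl n y))]//|nWy].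
by case: Wy.
Qed.

Hypothesis X_complete : forall F : set_system X,
  ProperFilter F -> cauchy F -> exists x : X, F --> x.

(** Closed neighbourhoods, since the limit in the Baire argument only inherits weak inequalities. *)
Let closed_near n y z := forall i, (i < n)%N -> mdist (y i) (z i) <= dyadic n.

Lemma baire_step D (s : (nat -> X) * nat) : open_seq D -> dense_seq D ->
  exists s' : (nat -> X) * nat, (s.2 < s'.2)%N /\
    forall z, closed_near s'.2 s'.1 z -> near_seq s.2 s.1 z /\ D z.
Proof.
case: s => y n Do Dd; have [z Dz yz] := Dd y n.
have [|N NP] := open_seqI (open_near_seq n y) Do (y := z); first by split.
(* One more halving of the radius puts the closed neighbourhood of z inside the open one of index
   N. *)
exists (z, (maxn n N).+1); split=> /=; first by rewrite ltnS leq_maxl.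
move=> w zw; apply: NP => i iN.
apply: le_lt_trans (zw i _) _.
  by rewrite ltnS leq_max (ltnW iN) orbT.
exact: lt_le_trans (dyadic_lt _) (dyadic_le (leq_maxr _ _)).
Qed.

Lemma baire_seq S W : comeager S -> open_seq W -> W !=set0 ->
  exists2 y, S y & W y.
Proof.
move=> [D [Dod DS]] Wo [y0 Wy0]; have [n0 n0W] := Wo _ Wy0.
have /choice[next nextP] : forall ks : nat * ((nat -> X) * nat),
    exists s' : (nat -> X) * nat, (ks.2.2 < s'.2)%N /\
    forall z, closed_near s'.2 s'.1 z -> near_seq ks.2.2 ks.2.1 z /\ D ks.1 z.
  by case=> k s; apply: baire_step; have [] := Dod k.
pose s := fix s k := if k is j.+1 then next (j, s j) else (y0, n0).
have sn k : (k <= (s k).2)%N.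
  elim: k => // k IH; have [h _] := nextP (k, s k).
  exact: leq_ltn_trans IH h.
have near_closed n y z : near_seq n y z -> closed_near n y z.
  by move=> h i /h/ltW.
have nested k j z : closed_near (s (j + k)%N).2 (s (j + k)%N).1 z ->
    closed_near (s k).2 (s k).1 z.
  elim: j => // j IH h; apply: IH; apply: near_closed.
  by have [_ /(_ z h)[]] := nextP ((j + k)%N, s (j + k)%N).
have sball k j : (k <= j)%N -> closed_near (s k).2 (s k).1 (s j).1.
  move=> kj; apply: (@nested _ (j - k)%N); rewrite subnK//.
  exact/near_closed/near_seq_refl.
(* The centres converge coordinate by coordinate: coordinate i is constrained by all closed
   neighbourhoods of index above i, whose radii tend to 0. *)
have /choice[lim limP] : forall i, exists l : X,
    (fun j => (s j).1 i) @ \oo --> l.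
  move=> i; apply: X_complete; apply/cauchy_ballP => e e0.
  have [n rn] := dyadic_lt_eps (divr_gt0 e0 (ltr0n _ 2)).
  pose k := maxn n i.+1; pose B := [set x : X | mdist ((s k).1 i) x <= dyadic k].
  have FB : ((fun j => (s j).1 i) @ \oo) B.
    exists k => // j /= /sball /(_ i) h; apply: le_trans (h _) (dyadic_le (sn k)).
    by apply: leq_trans (sn k); rewrite leq_max ltnSn orbT.
  exists (B, B) => // -[x x'] [/= Bx Bx'].
  rewrite ballEmdist /= (le_lt_trans (metric_triangle _ ((s k).1 i) _))//.
  rewrite [e]splitr metric_sym ltrD//; apply: le_lt_trans rn.
  - by apply: le_trans Bx _; apply/dyadic_le/leq_maxl.
  - by apply: le_trans Bx' _; apply/dyadic_le/leq_maxl.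
have limB k : closed_near (s k).2 (s k).1 lim.
  move=> i ik; apply/ler_addgt0Pr => e e0.
  have /(_ _ (nbhsx_ballx _ _ e0)) [n _ /(_ (maxn n k))] := limP i.
  rewrite /= leq_maxl ballEmdist => /(_ isT) /= le.
  apply: le_trans (metric_triangle _ ((s (maxn n k)).1 i) _) _.
  rewrite lerD// ?sball// ?leq_maxr// metric_sym; exact: ltW.
exists lim.
  by apply: DS => k; have [_ /(_ _ (limB k.+1))[]] := nextP (k, s k).
apply: n0W; have [_ /(_ _ (limB 1%N))[]//] := nextP (0%N, s 0%N).
Qed.

(** Tail-density follows from countably many conditions, one for each k, n, l: some entry after
    place k is within [dyadic l] of a n. Each is open, and dense because a basic neighbourhood
    leaves all late entries free. *)
Lemma comeager_tail_dense (a : nat -> X) : tail_dense a -> comeager (@tail_dense R X).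
Proof.
move=> a_dense.
pose D k n l : set (nat -> X) :=
  [set y | exists2 i, (k < i)%N & mdist (y i) (a n) < dyadic l].
suff : comeager (\bigcap_k \bigcap_n \bigcap_l D k n l).
  apply: sub_comeager => y yD k O [x Ox] Oo.
  have /nbhs_ballP[e e0 xO] : nbhs x O by apply: open_nbhs_nbhs.
  have [l rl] := dyadic_lt_eps (divr_gt0 e0 (ltr0n _ 2)).
  have [oB xB] := open_nbhs_ball x (PosNum (dyadic_gt0 l)).
  have [|w [/interior_subset + [n _ aw]]] := a_dense 0%N _ _ oB; first by exists x.
  rewrite ballEmdist/= -aw => xn.
  have [i ki yn] := yD k I n I l I.
  exists (y i); split; last by exists i.
  apply: xO; rewrite ballEmdist/= (le_lt_trans (metric_triangle _ (a n) _))//.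
  rewrite [e]splitr ltrD//; first exact: lt_trans rl.
  by rewrite metric_sym (lt_trans yn).
apply: comeager_bigcap => k; apply: comeager_bigcap => n; apply: comeager_bigcap => l.
exists (fun=> D k n l); split; last by move=> y /(_ 0%N).
move=> _; split.
- move=> y [i ki yl].
  have e0 : 0 < dyadic l - mdist (y i) (a n) by rewrite subr_gt0.
  have [N rN] := dyadic_lt_eps e0.
  exists (maxn N i.+1) => z yz; exists i => //.
  rewrite (le_lt_trans (metric_triangle _ (y i) _))// -ltrBrDr metric_sym.
  apply: lt_trans rN; apply: lt_le_trans (yz _ _) (dyadic_le (leq_maxl _ _)).
  by rewrite leq_max ltnSn orbT.
(* The place i is beyond k, as the condition demands, and beyond the entries fixed by the
   neighbourhood of index m, so a n can be put there. *)
- move=> y m; pose i := (maxn k m).+1.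
  exists (fun j => if j == i then a n else y j).
    by exists i; rewrite ?eqxx ?mdistxx ?dyadic_gt0// ltnS leq_maxl.
  move=> j jm; rewrite ifF ?mdistxx ?dyadic_gt0//.
  by apply/negbTE; rewrite neq_ltn /i (ltn_trans jm)// ltnS leq_maxr.
Qed.

End SequenceSpace.

(** * Infimal convolution formulas *)

Section RealContinuity.
Context {R : realType} {T : topologicalType}.
Implicit Types f g : T -> R.

Lemma continuous_realD f g :
  continuous f -> continuous g -> continuous (fun x => f x + g x).
Proof. by move=> fc gc x; apply: (@cvgD R R^o); [exact: fc|exact: gc]. Qed.

Lemma continuous_realM f g :
  continuous f -> continuous g -> continuous (fun x => f x * g x).
Proof. by move=> fc gc x; apply: cvgM; [exact: fc|exact: gc]. Qed.

Lemma continuous_real_min f g :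
  continuous f -> continuous g -> continuous (fun x => Num.min (f x) (g x)).
Proof.
by move=> fc gc x; apply: (@continuous_min R); [exact: fc|exact: gc].
Qed.

Lemma continuous_real_max f g :
  continuous f -> continuous g -> continuous (fun x => Num.max (f x) (g x)).
Proof.
by move=> fc gc x; apply: (@continuous_max R); [exact: fc|exact: gc].
Qed.

Lemma continuous_real_sum m (f : 'I_m -> T -> R) :
  (forall i, continuous (f i)) -> continuous (fun x => \sum_(i < m) f i x).
Proof.
move=> fc; apply: (@continuous_big R _ +%R 0 xpredT) => [|i _]; last exact: fc.
exact: add_continuous.
Qed.

End RealContinuity.

Lemma continuous_coord (R : realType) (I : eqType) (i : I) :
  continuous (fun x : {ptws I -> R} => x i).
Proof. exact: (@proj_continuous I (fun=> R) i). Qed.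

(** Values of formulas are compared below through strict upper bounds, because there an infimum
    turns into an existential quantifier even if it is not attained. *)
Lemma inf_ltP (R : realType) (S : set R) (b c : R) : S !=set0 -> lbound S b ->
  inf S < c <-> exists2 x, S x & x < c.
Proof.
move=> S0 Sb; have Si : has_inf S by split=> //; exists b.
split=> [ic|[x Sx]]; last by apply: le_lt_trans; apply: ge_inf => //; exists b.
have e0 : 0 < c - inf S by rewrite subr_gt0.
by have [x Sx] := inf_adherent e0 Si; rewrite subrKC; exists x.
Qed.

Section BlockFormulas.
Context {R : realType} {L : signature R}.
Implicit Types (phi psi : formula L) (s t m M K : nat) (h : R -> R).

Lemma conn_modulus_le m (J : 'I_m -> set R) (f : {ptws 'I_m -> R} -> R) delta (B : R) :
    0 <= B ->
    (forall x y, box J x -> box J y -> (forall i, `|x i - y i| <= delta i) ->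
      `|f x - f y| <= B) ->
  conn_modulus J f delta <= B.
Proof.
move=> B0 fB; rewrite /conn_modulus; set S := [set r | _].
(* The box may be empty; then the supremum is 0 by convention, and [B0] concludes. *)
have [->|/set0P S0] := eqVneq S set0; first by rewrite sup0.
by apply: ge_sup => // _ [x [y [xJ yJ xy ->]]]; exact: fB.
Qed.

(** The modulus of K-Lipschitz dependence on the m variables from s on. It is determined by s, m and
    K, so it can serve as the common modulus of a countable infimum. *)
Lemma block_modulus_subproof s m K :
  [/\ forall delta : {ptws nat -> R}, orthant R nat delta ->
        0 <= K%:R * \sum_(i < m) delta (s + i)%N,
      {within orthant R nat, continuous
        (fun delta : {ptws nat -> R} => K%:R * \sum_(i < m) delta (s + i)%N)},
      K%:R * \sum_(i < m) (fun=> 0 : R) (s + i)%N = 0,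
      forall delta delta' : {ptws nat -> R}, orthant R nat delta -> orthant R nat delta' ->
        K%:R * \sum_(i < m) delta (s + i)%N
          <= K%:R * \sum_(i < m) (delta (s + i)%N + delta' (s + i)%N) &
      forall delta delta' : {ptws nat -> R}, orthant R nat delta -> orthant R nat delta' ->
        K%:R * \sum_(i < m) (delta (s + i)%N + delta' (s + i)%N)
          <= K%:R * \sum_(i < m) delta (s + i)%N + K%:R * \sum_(i < m) delta' (s + i)%N].
Proof.
split.
- by move=> delta d0; rewrite mulr_ge0// sumr_ge0.
- apply/continuous_subspaceT/continuous_realM; first exact: cst_continuous.
  by apply: continuous_real_sum => i; exact: continuous_coord.
- by rewrite big1 ?mulr0.
- move=> delta delta' _ d'0; rewrite ler_wpM2l// ler_sum// => i _.
  by rewrite lerDl.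
- by move=> delta delta' _ _; rewrite big_split mulrDr.
Qed.

Definition block_modulus s m K : modulus R nat :=
  let: And5 h1 h2 h3 h4 h5 := block_modulus_subproof s m K in Modulus h1 h2 h3 h4 h5.

Lemma block_modulusE s m K delta :
  block_modulus s m K delta = K%:R * \sum_(i < m) delta (s + i)%N.
Proof. by rewrite /block_modulus; case: block_modulus_subproof. Qed.

Definition block s m : set nat := [set i | (s <= i < s + m)%N].

Fixpoint Infs t M phi : formula L :=
  if M is M'.+1 then Inf t (Infs t.+1 M' phi) else phi.

Lemma wf_Infs t M phi : wf (Infs t M phi) = wf phi.
Proof. by elim: M t => //= M IH t. Qed.

Lemma bound_Infs t M phi : bound (Infs t M phi) = bound phi.
Proof. by elim: M t => //= M IH t. Qed.

Lemma blockS t M i : block t M.+1 i <-> i = t \/ block t.+1 M i.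
Proof.
rewrite /block /= addnS addSn; split; last first.
  by move=> [->|/andP[/ltnW -> ->]//]; rewrite leqnn ltnS leq_addr.
by rewrite leq_eqVlt => /andP[/orP[/eqP|->]]; [left|right].
Qed.

Lemma formula_fv_Infs t M phi :
  formula_fv (Infs t M phi) `<=` formula_fv phi `\` block t M.
Proof.
elim: M t => [|M IH] t i /=.
  by move=> phi_i; split=> //; rewrite /block /= addn0 => /andP[]; case: ltngtP.
by move=> [/IH[phi_i ni] nt]; split=> // /blockS[].
Qed.

Lemma formula_modulus_Infs t M phi delta :
  formula_modulus (Infs t M phi) delta =
  formula_modulus phi (fun i => if (t <= i < t + M)%N then 0 else delta i).
Proof.
elim: M t delta => [|M IH] t delta /=.
  congr formula_modulus; apply/funext => i.
  by rewrite ifF// addn0; case: ltngtP.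
rewrite IH; congr formula_modulus; apply/funext => i /=.
rewrite addnS addSn; case: ltngtP => //= ->.
by rewrite ltnS leq_addr.
Qed.

(** Nonnegativity of phi keeps every set of values bounded below, so each [inf] is a genuine infimum
    and the variables can be eliminated one at a time. *)
Lemma value_Infs t M phi (A : structure L) (v : nat -> A) :
    (forall w : nat -> A, 0 <= value phi w) ->
  0 <= value (Infs t M phi) v /\
  forall c, value (Infs t M phi) v < c <-> exists w,
    (forall i, ~ block t M i -> w i = v i) /\ value phi w < c.
Proof.
move=> phi0; elim: M t v => [|M IH] t v /=.
  split=> // c; split=> [|[w [wv]]]; first by exists v.
  suff -> : w = v by [].
  apply/funext => i; apply: wv; rewrite /block /= addn0 => /andP[].
  by case: ltngtP.
set S := (X in 0 <= inf X).
have S0 : S !=set0 by exists (value (Infs t.+1 M phi) [eta v with t |-> v t]), (v t).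
have Sb : lbound S 0 by move=> _ [a _ <-]; have [] := IH t.+1 [eta v with t |-> a].
split; first exact: lb_le_inf.
move=> c; split.
  move=> /(inf_ltP _ S0 Sb)[_ [a _ <-]].
  have [_ /(_ c) [+ _]] := IH t.+1 [eta v with t |-> a].
  move=> /[apply] -[w [wv wc]]; exists w; split=> // i /blockS/not_orP[it iM].
  by rewrite wv//=; move/eqP/negbTE : it => ->.
move=> [w [wv wc]]; apply/(inf_ltP _ S0 Sb).
exists (value (Infs t.+1 M phi) [eta v with t |-> w t]); first by exists (w t).
have [_ /(_ c) [_ ]] := IH t.+1 [eta v with t |-> w t]; apply; exists w; split=> //.
move=> i iM /=; case: eqP => [->//|it].
by apply: wv => /blockS[].
Qed.

Definition dist_atom s t : formula L :=
  @Atom R L None (fun i : 'I_2 => Var (if i == ord0 then s else t)).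

(* The absolute values keep the bound of the connective within [0, 1], because
   the bound of the symbol d may contain negative numbers. *)
Definition infconv_fun h m K (x : {ptws 'I_m.+1 -> R}) : R :=
  Num.min 1 (h (x ord0) + K%:R * \sum_(k < m) `|x (lift ord0 k)|).
Arguments infconv_fun : clear implicits.

(** With psi over the block of M variables from t on, this is the infimal convolution of h(psi) with
    K times the distance between blocks, truncated at 1. Argument 0 of the connective is psi, the
    others are the m distances. *)
Definition infconv h s t M m K psi : formula L :=
  Infs t M (Conn m.+1 (infconv_fun h m K)
    (fun i => if unlift ord0 i is Some k then dist_atom (s + k) (t + k) else psi)).

Lemma infconv_fun_continuous h m K :
  continuous h -> continuous (infconv_fun h m K).
Proof.
move=> hc; apply: continuous_real_min; first exact: cst_continuous.
apply: continuous_realD.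
  by move=> x; apply: continuous_comp; [exact: continuous_coord|exact: hc].
apply: continuous_realM; first exact: cst_continuous.
apply: continuous_real_sum => i x.
apply: continuous_comp; first exact: continuous_coord.
exact: (@norm_continuous R R^o).
Qed.

Section InfConv.
Context (h : R -> R) (s t M m K : nat) (psi : formula L).
Hypotheses (h_cont : continuous h) (h_ge0 : forall u, 0 <= h u).
Hypotheses (st : (s + m <= t)%N) (mM : (m <= M)%N).

Lemma wf_infconv : wf psi -> wf (infconv h s t M m K psi).
Proof.
move=> wpsi; rewrite /infconv wf_Infs /=; split; first by move=> i; case: unliftP.
exact/continuous_subspaceT/infconv_fun_continuous.
Qed.

Lemma bound_infconv : bound (infconv h s t M m K psi) `<=` [set` `[0 : R, 1]].
Proof.
rewrite /infconv bound_Infs /= => _ [x _ <-].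
by rewrite /= in_itv /= le_min ler01 addr_ge0 ?mulr_ge0 ?sumr_ge0//= ge_min lexx.
Qed.

Lemma formula_fv_infconv : formula_fv psi `<=` block t M ->
  formula_fv (infconv h s t M m K psi) `<=` block s m.
Proof.
move=> fv_psi i /formula_fv_Infs[[j _]] /=; case: unliftP => [k|] _.
  move=> [l _ /=] -> nb.
  have := ltn_ord k; case: ifP nb => _ nb km.
    by rewrite /block /= leq_addr ltn_add2l.
  by exfalso; apply: nb; rewrite /block /= leq_addr ltn_add2l (leq_trans km).
by move=> /fv_psi.
Qed.

(** The quantifiers set delta to 0 on the block of psi, so the argument coming from psi cannot move
    and no modulus of h enters. The distance terms remain, and truncation and absolute value are
    nonexpansive. *)
Lemma formula_modulus_infconv :
    (forall delta, orthant R nat delta -> (forall i, block t M i -> delta i = 0) ->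
      formula_modulus psi delta <= 0) ->
  forall delta, orthant R nat delta ->
    formula_modulus (infconv h s t M m K psi) delta <= block_modulus s m K delta.
Proof.
move=> psi0 delta delta0; rewrite formula_modulus_Infs /=.
set eta := fun i => if _ then _ else _.
have eta0 : orthant R nat eta by move=> i; rewrite /eta; case: ifP => // _; exact: delta0.
apply: conn_modulus_le; first exact: modulus_ge0.
move=> x y _ _ xy; rewrite block_modulusE /infconv_fun.
have xy0 : x ord0 = y ord0.
  apply/eqP; rewrite -subr_eq0 -normr_le0 (le_trans (xy ord0))//.
  rewrite unlift_none; apply: psi0 => // i iM; by rewrite /eta ifT.
have xyk (k : 'I_m) : `|x (lift ord0 k) - y (lift ord0 k)| <= delta (s + k)%N.
  apply: le_trans (xy _) _; rewrite liftK /= /eta ifF; last first.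
    by apply/negbTE; rewrite negb_and -ltnNge (leq_trans _ st)// ltn_add2l.
  by rewrite ifT ?addr0// leq_addr ltn_add2l (leq_trans _ mM).
have minB (a b : R) : `|Num.min 1 a - Num.min 1 b| <= `|a - b|.
  rewrite !minEle; case: ifPn => [a1|]; case: ifPn => [b1|]; rewrite -?ltNge//.
  - by rewrite subrr normr0.
  - move=> b1; rewrite !ger0_norm ?subr_ge0 ?lerB// ?(ltW b1)//.
    exact: le_trans (ltW b1) a1.
  - move=> a1; rewrite !ler0_norm ?subr_le0 ?lerN2 ?lerB// ?(ltW a1)//.
    exact: le_trans (ltW a1) b1.
apply: le_trans (minB _ _) _.
rewrite xy0 opprD addrACA subrr add0r -mulrBr normrM normr_nat ler_wpM2l//.
rewrite -sumrB; apply: le_trans (ler_norm_sum _ _ _) _; apply: ler_sum => k _.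
exact: le_trans (ler_dist_dist _ _) (xyk k).
Qed.

Lemma value_infconv (A : structure L) (v : nat -> A) :
  0 <= value (infconv h s t M m K psi) v /\
  forall c, c <= 1 -> value (infconv h s t M m K psi) v < c <-> exists w,
    (forall i, ~ block t M i -> w i = v i) /\
    h (value psi w) + K%:R * \sum_(k < m) mdist (v (s + k)%N) (w (t + k)%N) < c.
Proof.
pose val w : R := h (value psi w) +
  K%:R * \sum_(k < m) mdist (w (s + k)%N) (w (t + k)%N : A).
rewrite /infconv; set phi := Conn _ _ _.
have phiE w : value phi w = Num.min 1 (val w).
  rewrite /= /infconv_fun unlift_none; congr (Num.min _ (_ + _ * _)).
  apply: eq_bigr => k _; rewrite liftK /= ger0_norm//; exact: mdist_ge0.
have val0 w : 0 <= val w.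
  by rewrite addr_ge0// mulr_ge0// sumr_ge0// => k _; exact: mdist_ge0.
have phi0 (w : nat -> A) : 0 <= value phi w by rewrite phiE le_min ler01 val0.
have [ge0 lt] := value_Infs t M v phi0; split=> // c c1.
(* The free block ends before t, so a change of the quantified variables does not touch it. *)
have valE w : (forall i, ~ block t M i -> w i = v i) ->
    val w = h (value psi w) + K%:R * \sum_(k < m) mdist (v (s + k)%N) (w (t + k)%N).
  move=> wv; congr (_ + _ * _); apply: eq_bigr => k _; rewrite wv//.
  rewrite /block /= => /andP[]; rewrite leqNgt (leq_trans _ st)//.
  by rewrite ltn_add2l.
split=> [/lt[w [wv]]|[w [wv wc]]].
  rewrite phiE gt_min ltNge c1 /= valE// => ?; by exists w.
by apply/lt; exists w; rewrite phiE gt_min valE// wc orbT.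
Qed.

End InfConv.
End BlockFormulas.

(** * Definable sets of codes *)

Lemma cvg_prod_topology (I : Type) (K : I -> topologicalType)
    (F : set_system (prod_topology K)) {FF : Filter F} (x : prod_topology K) :
  (forall i, (fun f => f i) @ F --> x i) -> F --> x.
Proof.
move=> Fx; apply/cvg_sup => i A [_ [[B Bo <-] Bx BA]].
have /Fx : nbhs (x i) B by apply: open_nbhs_nbhs.
exact: (@filterS _ F _ _ A BA).
Qed.

Section Definable.
Context {R : realType} {L : signature R}.
Implicit Types (phi psi : formula L) (s t m M K : nat) (A : structure L)
  (B : set (structure_space L)).

(** In contrast to [codes], density of y is not demanded here; it is supplied later by
    genericity. *)
Definition is_code A (p : code_space L) (y : nat -> A) : Prop :=
  forall (s : graph_predicate L) (j : 'I_(graph_arity s) -> nat),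
    p s j = graph_interp A s (y \o j).

Definition block_formula s m K phi : Prop :=
  [/\ wf phi, formula_fv phi `<=` block s m &
      formula_respects (block_modulus s m K) [set` `[0 : R, 1]] phi].

(* Above 1 the value is not controlled, so that W may be empty. *)
Definition defines_distance A (W : set (nat -> A)) s m K phi : Prop :=
  forall v, 0 <= value phi v /\ forall c, c <= 1 ->
    value phi v < c <->
    exists2 y, W y & K%:R * \sum_(k < m) mdist (v (s + k)%N) (y k) < c.

(** Having a formula for every starting variable s replaces substitution when a block is to be
    quantified. All m and K are included because separating a point from W may take many coordinates
    and a large factor. *)
Definition definable B : Prop :=
  exists phi : nat -> nat -> nat -> formula L,
    (forall s m K, block_formula s m K (phi s m K)) /\
    forall A, exists W : set (nat -> A), [/\ open_seq W,
      comeager [set y | forall p, is_code (\val p) y -> (W y <-> B p)] &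
      forall s m K, defines_distance W s m K (phi s m K)].

Lemma block_formula_BigInf s m K (phi : nat -> formula L) :
    (forall n, block_formula s m K (phi n)) ->
  block_formula s m K (BigInf (block_modulus s m K) [set` `[0 : R, 1]] phi).
Proof.
move=> phiP; split => /=.
- split; [by exists 0, 1|by move=> n; have [] := phiP n|].
  by move=> n; have [] := phiP n.
- by move=> i [n _]; have [_ + _] := phiP n; exact.
- by split.
Qed.

Lemma value_BigInf Delta J (phi : nat -> formula L) A (v : nat -> A) :
    (forall n, 0 <= value (phi n) v) ->
  0 <= value (BigInf Delta J phi) v /\
  forall c, value (BigInf Delta J phi) v < c <-> exists n, value (phi n) v < c.
Proof.
move=> phi0 /=; set S := (X in 0 <= inf X).
have S0 : S !=set0 by exists (value (phi 0%N) v), 0%N.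
have Sb : lbound S 0 by move=> _ [n _ <-].
split; first exact: lb_le_inf.
move=> c; split=> [/(inf_ltP _ S0 Sb)[_ [n _ <-]]|[n nc]]; first by exists n.
by apply/(inf_ltP _ S0 Sb); exists (value (phi n) v) => //; exists n.
Qed.

Lemma definable_bigcup (B : nat -> set (structure_space L)) :
  (forall n, definable (B n)) -> definable (\bigcup_n B n).
Proof.
move=> /choice[phi /all_and2[phiP phiW]].
exists (fun s m K => BigInf (block_modulus s m K) [set` `[0 : R, 1]]
  (fun n => phi n s m K)); split; first by move=> s m K; exact: block_formula_BigInf.
move=> A; have /choice[W /all_and3[Wo Wc Wd]] := fun n => phiW n A.
exists (\bigcup_n W n); split.
- move=> y [n _ /Wo[N NW]]; exists N => z /NW; by exists n.
- apply: sub_comeager (comeager_bigcap Wc) => y yW p yp.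
  by split=> -[n _ h]; exists n => //; apply/(yW n I p yp).
move=> s m K v.
have [|ge0 lt] := @value_BigInf (block_modulus s m K) [set` `[0 : R, 1]]
    (fun n => phi n s m K) A v.
  by move=> n; have [] := Wd n s m K v.
split=> // c c1; split=> [/lt[n]|[y [n _ Wy]] yc].
  have [_ /(_ c c1)[+ _]] := Wd n s m K v.
  by move=> /[apply] -[y Wy yc]; exists y => //; exists n.
apply/lt; exists n; have [_ /(_ c c1)[_]] := Wd n s m K v.
by apply; exists y.
Qed.

(** The common pattern of complements and cylinders. The penalty h = max(0, 1 - g) is at least 1
    where g is not positive, so a value below c <= 1 forces a witness with g > 0, which lies in W.
    Conversely a point of W makes g at least 1 for some n, hence costs only its distance. *)
Lemma definable_infconv (g : nat -> R -> R) (M : nat -> nat)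
    (psi : nat -> nat -> formula L) B :
    (forall n, continuous (g n)) ->
    (forall n t, wf (psi n t)) ->
    (forall n t, formula_fv (psi n t) `<=` block t (M n)) ->
    (forall n t delta, orthant R nat delta ->
      (forall i, block t (M n) i -> delta i = 0) ->
      formula_modulus (psi n t) delta <= 0) ->
    (forall A, exists W : set (nat -> A), [/\ open_seq W,
      comeager [set y | forall p, is_code (\val p) y -> (W y <-> B p)],
      forall t y, W y -> exists n, forall w : nat -> A,
        (forall i, (i < M n)%N -> w (t + i)%N = y i) ->
        1 <= g n (value (psi n t) w) &
      forall t n (w : nat -> A),
        0 < g n (value (psi n t) w) -> W (fun i => w (t + i)%N)]) ->
  definable B.
Proof.
move=> g_cont psi_wf psi_fv psi0 psiW.
pose h n u : R := Num.max 0 (1 + -1 * g n u).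
have h_cont n : continuous (h n).
  apply: continuous_real_max; first exact: cst_continuous.
  apply: continuous_realD; first exact: cst_continuous.
  by apply: continuous_realM => //; exact: cst_continuous.
have h_ge0 n u : 0 <= h n u by rewrite /h le_max lexx.
have M_le m n : (m <= maxn (M n) m)%N by rewrite leq_maxr.
have blockM n t m : block t (M n) `<=` block t (maxn (M n) m).
  move=> i /andP[ti iM]; rewrite /block /= ti (leq_trans iM)//.
  by rewrite leq_add2l leq_maxl.
(* The quantified block starts right after the free one; it has room for the variables of psi and
   for the m variables compared with the free ones. *)
pose phi s m K n := infconv (h n) s (s + m) (maxn (M n) m) m K (psi n (s + m)%N).
exists (fun s m K => BigInf (block_modulus s m K) [set` `[0 : R, 1]] (phi s m K)).
split.
  move=> s m K; apply: block_formula_BigInf => n; split.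
  - by apply: wf_infconv.
  - apply: formula_fv_infconv => //.
    exact: subset_trans (psi_fv _ _) (blockM _ _ _).
  - split; last exact: bound_infconv.
    move=> delta; apply: formula_modulus_infconv => //.
    by move=> delta' d0 dM; apply: psi0 => // i /blockM /dM.
move=> A; have [W [Wo Wc WE WI]] := psiW A; exists W; split=> // s m K v.
have phi_val n := value_infconv (maxn (M n) m) K (psi n (s + m)%N)
  (h_ge0 n) (leqnn (s + m)) v.
have [|ge0 lt] := @value_BigInf (block_modulus s m K) [set` `[0 : R, 1]]
    (phi s m K) A v; first by move=> n; have [] := phi_val n.
have dist0 (y : nat -> A) : 0 <= K%:R * \sum_(k < m) mdist (v (s + k)%N) (y k).
  by rewrite mulr_ge0// sumr_ge0// => k _; exact: mdist_ge0.
split=> // c c1; split=> [/lt[n]|[y Wy yc]].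
  have [_ /(_ c c1)[+ _]] := phi_val n.
  move=> /[apply] -[w [_ wc]]; exists (fun i => w (s + m + i)%N).
    apply: (WI _ n); rewrite ltNge; apply/negP => g0.
    have h1 : 1 <= h n (value (psi n (s + m)%N) w).
      by rewrite /h le_max mulN1r lerDl oppr_ge0 g0 orbT.
    have := le_lt_trans (lerD h1 (dist0 (fun i => w (s + m + i)%N))) wc.
    by rewrite addr0 ltNge c1.
  by apply: le_lt_trans wc; rewrite lerDr.
have [n nP] := WE (s + m)%N y Wy; apply/lt; exists n.
have [_ /(_ c c1)[_ ]] := phi_val n; apply.
(* The witness writes the point y of W into the quantified block and leaves the other variables as
   in v. *)
pose w i := if (s + m <= i < s + m + maxn (M n) m)%N then y (i - (s + m))%N else v i.
have wy i : (i < maxn (M n) m)%N -> w (s + m + i)%N = y i.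
  by move=> im; rewrite /w leq_addr ltn_add2l im /= addKn.
exists w; split; first by move=> i /negP/negbTE ib; rewrite /w ib.
rewrite (_ : h n _ = 0) ?add0r.
  under eq_bigr => k _ do rewrite wy ?(leq_trans (ltn_ord k))//.
  exact: yc.
apply/max_idPl; rewrite mulN1r subr_le0 nP// => i iM.
by rewrite wy// (leq_trans iM)// leq_maxl.
Qed.

Lemma sum_mdist_near A m K (c : R) : 0 < c ->
  exists n, forall y z : nat -> A, near_seq n y z ->
    K%:R * \sum_(k < m) mdist (y k) (z k) < c.
Proof.
(* The successor keeps the divisor positive when K or m is 0. *)
move=> c0; have a0 : 0 < (K * m).+1%:R :> R by rewrite ltr0n.
have [n nc] := dyadic_lt_eps (divr_gt0 c0 a0).
exists (maxn n m) => y z yz.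
have : K%:R * \sum_(k < m) mdist (y k) (z k) <= (K * m)%:R * dyadic n.
  rewrite natrM -mulrA ler_wpM2l//; apply: le_trans (ler_sum _ _) _.
    move=> k _; apply/ltW/(lt_le_trans (yz k _))/dyadic_le/leq_maxl.
    by rewrite leq_max ltn_ord orbT.
  by rewrite sumr_const card_ord mulr_natl.
move=> /le_lt_trans; apply; move: nc; rewrite ltr_pdivlMr// mulrC.
by apply: le_lt_trans; rewrite ler_wpM2r ?(ltW (dyadic_gt0 _))// ler_nat.
Qed.

(* The point [y] is outside the closure of [W] iff one of the truncated
   distances to [W] is positive at [y], and then another one equals 1. *)
Lemma definable_setC B : definable B -> definable (~` B).
Proof.
move=> [phi [phiP phiW]].
pose mK n : nat * nat := odflt (0, 0)%N (unpickle n).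
pose psi n t := phi t (mK n).1 (mK n).2.
apply: (@definable_infconv (fun=> id) (fun n => (mK n).1) psi).
- by move=> n u.
- by move=> n t; have [] := phiP t (mK n).1 (mK n).2.
- by move=> n t; have [] := phiP t (mK n).1 (mK n).2.
- move=> n t delta d0 dM; have [_ _ [/(_ _ d0) + _]] := phiP t (mK n).1 (mK n).2.
  move=> /le_trans; apply; rewrite block_modulusE big1 ?mulr0// => k _.
  by apply: dM; rewrite /block /= leq_addr ltn_add2l ltn_ord.
move=> A; have [W [Wo Wc Wd]] := phiW A; exists (exterior_seq W); split.
- exact: open_exterior_seq.
- apply: sub_comeager (comeagerI Wc (comeager_exterior_seq Wo)) => y [yW yext] p yp.
  by split=> [/yext nW /(yW p yp)//|nB]; apply/yext => /(yW p yp).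
- move=> t y [n yn].
  (* With m = n and K = 2^n, any z in W is at distance at least [dyadic n] from y in one of the
     first n coordinates, which alone contributes at least 1 to the sum. *)
  have [K nK] : exists K : nat, 1 <= K%:R * dyadic n :> R.
    exists (2 ^ n)%N; rewrite /dyadic natrX -exprMn divff ?expr1n//.
  exists (pickle (n, K)) => w; rewrite /psi /mK pickleK /= => wy.
  have [_ /(_ 1 (lexx _))[+ _]] := Wd t n K w.
  rewrite leNgt => h; apply/negP => /h[z Wz].
  apply/negP; rewrite -leNgt; apply: contrapT => /negP; rewrite -ltNge => lt1.
  apply: (yn z) => // i im; rewrite ltNge; apply/negP => rz.
  move: lt1; rewrite ltNge => /negP; apply.
  apply: le_trans nK _; rewrite ler_wpM2l//.
  rewrite (bigD1 (Ordinal im)) //= wy//; apply: le_trans rz _.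
  by rewrite lerDl sumr_ge0// => k _; exact: mdist_ge0.
move=> t n w; set u := value _ _ => u0.
(* A point of W close enough to the tuple would push u below min(u, 1), hence below itself; the
   minimum with 1 keeps the threshold where [defines_distance] applies. *)
have c0 : 0 < Num.min u 1 by rewrite lt_min u0 ltr01.
have [N NP] := sum_mdist_near A (mK n).1 (mK n).2 c0.
exists N => z wz Wz.
have [_ /(_ (Num.min u 1))] := Wd t (mK n).1 (mK n).2 w.
rewrite ge_min lexx orbT => /(_ isT)[_ h].
have : u < Num.min u 1 by apply: h; exists z => //; exact: NP wz.
by rewrite lt_min ltxx.
Qed.

(** A graph predicate of F is not a symbol of L, so it is written as the distance atom between F(x)
    and y; entry k of the sequence is the variable t + k. *)
Definition graph_atom t (s : graph_predicate L) :
    ('I_(graph_arity s) -> nat) -> formula L :=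
  match s return ('I_(graph_arity s) -> nat) -> formula L with
  | inl P => fun j => Atom P (fun i => Var (t + j i)%N)
  | inr F => fun j => @Atom R L None (fun i : 'I_2 => if i == ord0
      then App F (fun k => Var (t + j (widen_ord (leqnSn _) k))%N)
      else Var (t + j ord_max)%N)
  end.

Lemma value_graph_atom t (s : graph_predicate L) (j : 'I_(graph_arity s) -> nat)
    A (w : nat -> A) :
  value (graph_atom t j) w = graph_interp A s ((fun i => w (t + i)%N) \o j).
Proof. by case: s j => [[P|]|F] j. Qed.

Lemma wf_graph_atom t (s : graph_predicate L) (j : 'I_(graph_arity s) -> nat) :
  wf (graph_atom t j).
Proof. by case: s j => [[P|]|F] j. Qed.

Lemma formula_fv_graph_atom t M (s : graph_predicate L)
    (j : 'I_(graph_arity s) -> nat) :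
  (forall i, (j i < M)%N) -> formula_fv (graph_atom t j) `<=` block t M.
Proof.
have tM k : (k < M)%N -> block t M (t + k)%N.
  by move=> kM; rewrite /block /= leq_addr ltn_add2l.
case: s j => [P|F] j jM i /= [k _] /=; first by move=> ->; exact: tM.
by case: ifP => _ /=; [move=> [l _ ->]|move=> ->]; exact: tM.
Qed.

Lemma formula_modulus_graph_atom t M (s : graph_predicate L)
    (j : 'I_(graph_arity s) -> nat) delta :
    (forall i, (j i < M)%N) -> (forall i, block t M i -> delta i = 0) ->
  formula_modulus (graph_atom t j) delta = 0.
Proof.
move=> jM dM.
have d0 i : delta (t + j i)%N = 0.
  by apply: dM; rewrite /block /= leq_addr ltn_add2l jM.
case: s j {jM} d0 => [[P|]|F] j d0 /=.
- by rewrite -[RHS](modulus0 (rel_modulus P)); congr modulus_fun; apply/funext.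
- by rewrite !d0 addr0.
- rewrite d0 addr0 -[RHS](modulus0 (func_modulus F)); congr modulus_fun.
  by apply/funext => k; rewrite d0.
Qed.

(** Continuity at 0 along the diagonal gives one constant tuple with a small value, and monotonicity
    carries the bound to all tuples below it. *)
Lemma modulus_small k (Delta : modulus R 'I_k) (e : R) : 0 < e ->
  exists2 r : R, 0 < r & forall delta, (forall i, 0 <= delta i < r) -> Delta delta < e.
Proof.
move=> e0.
(* The absolute value keeps the diagonal inside the orthant, where alone the modulus is
   continuous. *)
have cst_cont : continuous ((fun u => fun=> `|u|) : R -> {ptws 'I_k -> R}).
  by move=> u; apply: cvg_prod_topology => i; exact: (@norm_continuous R R^o).
have o0 (u : R) : orthant R 'I_k (fun=> `|u|) by move=> i; exact: normr_ge0.
have /subspace_continuousP/(_ _ (o0 0))/cvgrPdist_lt/(_ _ e0) :=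
  @modulus_continuous _ _ Delta.
rewrite near_withinE => /cst_cont /nbhs_ballP[r r0 rD].
exists (r / 2); first by rewrite divr_gt0.
move=> delta dr.
have h : `|Delta (fun=> 0) - Delta (fun=> r / 2)| < e.
  have := rD (r / 2); rewrite /ball /= sub0r normrN gtr0_norm ?divr_gt0//.
  rewrite normr0 ltr_pdivrMr// ltr_pMr// ltr1n => /(_ isT); apply.
  by move=> i; rewrite ltW// divr_gt0.
rewrite modulus0 sub0r normrN in h.
have d0 : orthant R 'I_k delta by move=> i; have /andP[] := dr i.
have d'0 : orthant R 'I_k (fun i => r / 2 - delta i).
  by move=> i; have /andP[_ /ltW] := dr i; rewrite subr_ge0.
apply: le_lt_trans (modulus_le Delta d0 d'0) _.
apply: le_lt_trans (ler_norm _) _; apply: le_lt_trans h.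
rewrite le_eqVlt; apply/orP; left; apply/eqP; congr (`|Delta _|).
by apply/funext => i; rewrite subrKC.
Qed.

Lemma graph_interp_near (s : graph_predicate L) (j : 'I_(graph_arity s) -> nat)
    A (y : nat -> A) (e : R) : 0 < e ->
  exists n, forall z, near_seq n y z ->
    `|graph_interp A s (y \o j) - graph_interp A s (z \o j)| < e.
Proof.
move=> e0.
have [r r0 rP] : exists2 r : R, 0 < r & forall z,
    (forall i, mdist (y (j i)) (z (j i)) < r) ->
    `|graph_interp A s (y \o j) - graph_interp A s (z \o j)| < e.
  have dist_le (a b a' b' : A) : `|mdist a b - mdist a' b'| <= mdist a a' + mdist b b'.
    have tri (u v u' v' : A) : mdist u v - mdist u' v' <= mdist u u' + mdist v v'.
      rewrite lerBlDr (le_trans (metric_triangle _ u' _))// -addrA lerD2l.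
      rewrite addrC (le_trans (metric_triangle _ v' _))// lerD2l.
      by rewrite (metric_sym v).
    rewrite ler_norml tri andbT lerNl opprB.
    by rewrite (metric_sym a a') (metric_sym b b') tri.
  have e20 : 0 < e / 2 by rewrite divr_gt0.
  case: s j => [[P|]|F] j /=.
  - have [r r0 rP] := modulus_small (rel_modulus P) e0; exists r => // z zr.
    have := @rel_respects R L A P (z \o j) (y \o j).
    move=> /le_lt_trans; apply; apply: rP => i /=.
    by rewrite mdist_ge0 metric_sym zr.
  - exists (e / 2) => // z zr; apply: le_lt_trans (dist_le _ _ _ _) _.
    by rewrite [e]splitr ltrD.
  - have [r r0 rP] := modulus_small (func_modulus F) e20.
    exists (Num.min r (e / 2)); first by rewrite lt_min r0.
    move=> z zr; apply: le_lt_trans (dist_le _ _ _ _) _.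
    have {}zr i : (mdist (y (j i)) (z (j i)) < r) && (mdist (y (j i)) (z (j i)) < e / 2).
      by rewrite -lt_min.
    rewrite [e]splitr ltrD//; last by have /andP[] := zr ord_max.
    apply: le_lt_trans (func_respects _ _) _; apply: rP => i /=.
    by rewrite mdist_ge0; have /andP[] := zr (widen_ord (leqnSn _) i).
have [n rn] := dyadic_lt_eps r0.
exists (maxn n (\max_i j i).+1) => z yz; apply: rP => i.
apply: lt_trans rn; apply: lt_le_trans (yz _ _) (dyadic_le (leq_maxl _ _)).
by rewrite leq_max ltnS (leq_bigmax i) orbT.
Qed.

Definition cylinder (s : graph_predicate L) (j : 'I_(graph_arity s) -> nat)
    (a b : R) : set (code_space L) :=
  [set p | a < p s j < b].

Lemma definable_cylinder (s : graph_predicate L) (j : 'I_(graph_arity s) -> nat)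
  (a b : R) : definable (\val @^-1` cylinder j a b).
Proof.
(* The gap is positive exactly on the open interval, and its multiples by n + 1 eventually reach 1
   there, as [definable_infconv] requires. *)
pose gap u := Num.min (u + - a) (b + -1 * u).
have gap_gt0 u : (0 < gap u) = (a < u < b).
  by rewrite /gap lt_min mulN1r !subr_gt0.
have jM i : (j i < (\max_i j i).+1)%N by rewrite ltnS (leq_bigmax i).
apply: (@definable_infconv (fun n u => n.+1%:R * gap u) (fun=> (\max_i j i).+1)
  (fun _ t => graph_atom t j)).
- move=> n; apply: continuous_realM; first exact: cst_continuous.
  apply: continuous_real_min; apply: continuous_realD; try exact: cst_continuous.
    by move=> u.
  by apply: continuous_realM; [exact: cst_continuous|move=> u].
- by move=> n t; exact: wf_graph_atom.
- by move=> n t; exact: formula_fv_graph_atom.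
- by move=> n t delta d0 dM; rewrite (formula_modulus_graph_atom jM dM).
move=> A; exists [set y : nat -> A | 0 < gap (graph_interp A s (y \o j))]; split.
- move=> y /= gy; have [n nP] := graph_interp_near j y gy.
  exists n => z /nP; move: gy; rewrite !gap_gt0 /gap; set u := graph_interp _ _ _.
  set u' := graph_interp _ _ _ => /andP[au ub]; rewrite lt_min mulN1r !ltr_norml.
  by move=> /andP[/andP[? ?] /andP[? ?]]; apply/andP; split; lra.
- exists (fun=> setT); split.
    move=> _; split; first by move=> y _; exists 0%N.
    by move=> y n; exists y => //; exact: near_seq_refl.
  by move=> y _ p yp /=; rewrite gap_gt0 /cylinder /= yp.
- move=> t y /= gy.
  have [n nP] : exists n, 1 <= n.+1%:R * gap (graph_interp A s (y \o j)).
    have [n ng] := dyadic_lt_eps gy; exists (2 ^ n)%N.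
    apply: (@le_trans _ _ ((2 ^ n)%:R * dyadic n)).
      by rewrite /dyadic natrX -exprMn divff ?expr1n.
    by apply: ler_pM; rewrite ?ler0n ?ler_nat// ltW// dyadic_gt0.
  exists n => w wy; rewrite value_graph_atom (_ : _ \o j = y \o j)//.
  by apply/funext => i /=; rewrite wy.
- by move=> t n w; rewrite value_graph_atom /= pmulr_rgt0.
Qed.

End Definable.

(** * Borel sets and the theorem *)

Section Borel.
Context {R : realType} {L : signature R}.
Implicit Types (B : set (structure_space L)).

Lemma sigma_algebra_definable : sigma_algebra setT (@definable R L).
Proof.
split=> [|B|B]; last exact: definable_bigcup.
  (* The empty set is the cylinder over the empty interval from 1 to 0. *)
  have := @definable_cylinder R L (inl None) (fun=> 0%N) 1 0.
  rewrite (_ : _ @^-1` _ = set0)// -subset0 => p /andP[/lt_trans/[apply]].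
  by rewrite ltr10.
by rewrite setTD; exact: definable_setC.
Qed.

Lemma definable_setI B B' : definable B -> definable B' -> definable (B `&` B').
Proof.
move=> dB dB'; rewrite -[B `&` B']setCK setCI; apply: definable_setC.
rewrite -bigcup2E; apply: definable_bigcup => -[|[|n]] /=.
- exact: definable_setC.
- exact: definable_setC.
- by have [] := sigma_algebra_definable.
Qed.

(** Codes for a symbol, an entry of its table and a rational interval. Coding symbols by numbers
    makes this a countable type, so finite lists of indices can be enumerated. *)
Let index := (nat * seq nat * (rat * rat))%type.

Let basic (e : graph_predicate L -> nat) (c : index) : set (code_space L) :=
  [set p | exists2 s, e s = c.1.1 &
    cylinder (fun i : 'I_(graph_arity s) => nth 0%N c.1.2 i)
      (ratr c.2.1) (ratr c.2.2) p].

Let basics (e : graph_predicate L -> nat) (cs : seq index) : set (code_space L) :=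
  [set p | forall c, c \in cs -> basic e c p].

Lemma definable_basics (e : graph_predicate L -> nat) cs :
  injective e -> definable (\val @^-1` basics e cs).
Proof.
move=> e_inj; have [d0 _ _] := sigma_algebra_definable.
have basicP c : definable (\val @^-1` basic e c).
  have [[s es]|nes] := pselect (exists s, e s = c.1.1); last first.
    rewrite (_ : _ @^-1` _ = set0)// -subset0 => p [s es _].
    by apply: nes; exists s.
  have := @definable_cylinder R L s (fun i => nth 0%N c.1.2 i) (ratr c.2.1) (ratr c.2.2).
  congr definable; apply/seteqP; split=> p; first by exists s.
  by move=> [s' es']; have -> : s' = s by apply: e_inj; rewrite es es'.
elim: cs => [|c cs IH].
  rewrite (_ : _ @^-1` _ = ~` set0); first exact: definable_setC.
  by rewrite setC0 -subTset.
have := definable_setI (basicP c) IH; congr definable; apply/seteqP; split=> p.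
  by move=> [pc pcs] c'; rewrite inE => /predU1P[->//|/pcs].
by move=> pcs; split=> [|c' cc']; apply: pcs; rewrite inE ?eqxx// cc' orbT.
Qed.

(** The sets [basics e cs] that contain p generate a filter. It converges to p in every coordinate
    by density of the rationals, hence in the product. *)
Lemma basics_nbhs (e : graph_predicate L -> nat) (O : set (code_space L)) p :
  injective e -> open O -> O p -> exists cs, basics e cs p /\ basics e cs `<=` O.
Proof.
move=> e_inj Oo Op.
pose F := filter_from [set cs | basics e cs p] (basics e).
have FF : Filter F.
  apply: filter_from_filter; first by exists [::].
  move=> cs cs' pcs pcs'; exists (cs ++ cs').
    by move=> c; rewrite mem_cat => /orP[/pcs|/pcs'].
  by move=> q qcs; split=> c ccs; apply: qcs; rewrite mem_cat ccs ?orbT.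
suff Fp : F --> p.
  by have [cs pcs csO] := Fp O (open_nbhs_nbhs (conj Oo Op)); exists cs.
apply: cvg_prod_topology => s; apply: cvg_prod_topology => j.
apply/cvgrPdist_lt => eps eps0.
have /rat_in_itvoo[q1] : p s j - eps < p s j by rewrite gtrBl.
rewrite in_itv /= => /andP[q1l q1r].
have /rat_in_itvoo[q2] : p s j < p s j + eps by rewrite ltrDl.
rewrite in_itv /= => /andP[q2l q2r].
pose c : index := (e s, [seq j i | i <- enum 'I_(graph_arity s)], (q1, q2)).
have cj : (fun i : 'I_(graph_arity s) => nth 0%N c.1.2 i) = j.
  by apply/funext => i; rewrite (nth_map i) ?size_enum_ord// nth_ord_enum.
exists [:: c].
  by move=> _ /[!inE] /eqP ->; exists s => //; rewrite cj /cylinder /= q1r q2l.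
move=> q /(_ c (mem_head _ _))[s' /e_inj es']; move: es' => -> {s'}.
rewrite cj => /andP[q1q qq2]; rewrite /= ltr_norml.
by apply/andP; split; lra.
Qed.

Lemma definable_borel : countable_signature L ->
  <<s @open (structure_space L) >> `<=` @definable R L.
Proof.
move=> [/countable_injP[ef ef_inj] /countable_injP[er er_inj]].
have [e e_inj] : exists e : graph_predicate L -> nat, injective e.
  exists (fun s => pickle (match s with
    | inl None => inl tt
    | inl (Some r) => inr (inl (er r))
    | inr f => inr (inr (ef f)) end : unit + (nat + nat))).
  move=> s s' /(pcan_inj pickleK); case: s => [[r|]|f]; case: s' => [[r'|]|f'] //= [].
    by move=> /er_inj ->//; rewrite inE.
  by move=> /ef_inj ->//; rewrite inE.
apply: smallest_sub; first exact: sigma_algebra_definable.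
move=> _ [V Vo <-].
(* An open set is the union of the basic sets inside it, indexed by the numbers that code their
   lists. *)
pose B n : set (structure_space L) :=
  if unpickle n is Some cs then
    if `[< basics e cs `<=` V >] then \val @^-1` basics e cs else set0
  else set0.
have [d0 _ _] := sigma_algebra_definable.
have : definable (\bigcup_n B n).
  apply: definable_bigcup => n; rewrite /B; case: unpickle => // cs.
  by case: ifP => // _; exact: definable_basics.
congr definable; apply/seteqP; split=> p.
  move=> [n _]; rewrite /B; case: unpickle => // cs.
  by case: asboolP => // csV /csV.
move=> Vp; have [cs [pcs csV]] := basics_nbhs e_inj Vo Vp.
by exists (pickle cs) => //; rewrite /B pickleK asboolT.
Qed.

End Borel.

Lemma value_invariant_definable (R : realType) (L : signature R)
    (B : set (structure_space L)) : definable B ->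
    (forall (p q : structure_space L) (A : structure L),
      codes (\val p) A -> codes (\val q) A -> B p -> B q) ->
  exists2 psi : formula L, block_formula 0 0 0 psi &
    forall (p : structure_space L) (A : structure L), codes (\val p) A ->
      forall v : nat -> A, (B p -> value psi v = 0) /\ (~ B p -> 1 <= value psi v).
Proof.
move=> [phi [phiP phiW]] B_inv; exists (phi 0 0 0)%N => // p A pA v.
have [W [Wo Wc Wd]] := phiW A; have [val0 lt] := Wd 0%N 0%N 0%N v.
have [sepA [a [a_dense pa]]] := pA.
(* By Baire, V contains a tail-dense y whose code q is in B iff y is in W; since q and p code the
   same structure, invariance replaces q by p. *)
have generic V : open_seq V -> V !=set0 -> exists2 y, V y & W y <-> B p.
  move=> Vo V0.
  have [y [yW y_dense] Vy] := baire_seq (@carrier_complete R L A)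
    (comeagerI Wc (comeager_tail_dense a_dense)) Vo V0.
  exists y => //; pose q : code_space L := fun s j => graph_interp A s (y \o j).
  have qA : codes q A by split=> //; exists y.
  have q_in : q \in structure_space L by rewrite inE; exists A.
  have [WB BW] := yW (exist _ q q_in) (fun _ _ => erefl).
  split=> [/WB|/(B_inv p (exist _ q q_in) A pA qA)/BW//].
  exact: (B_inv (exist _ q q_in) p A qA pA).
split=> [Bp|nBp].
  have [||y _ [_ /(_ Bp) Wy]] := generic setT.
  - by move=> y _; exists 0%N.
  - by exists v.
  apply/eqP; rewrite eq_le val0 andbT leNgt; apply/negP => val_gt0.
  have c1 : Num.min (value (phi 0 0 0)%N v) 1 <= 1 by rewrite ge_min lexx orbT.
  suff : value (phi 0 0 0)%N v < Num.min (value (phi 0 0 0)%N v) 1.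
    by rewrite lt_min ltxx.
  by apply/(lt _ c1); exists y => //; rewrite mul0r lt_min val_gt0 ltr01.
(* A value below 1 makes W nonempty, and a generic point of W itself would put p in B. *)
rewrite leNgt; apply/negP => /(lt _ (lexx _))[y0 Wy0 _].
by have [|y Wy [/(_ Wy)]] := generic W Wo; first by exists y0.
Qed.

Theorem theorem1p4 (R : realType) (L : signature R)
    (L_countable : countable_signature L)
    (U : structure_space L -> R)
    (U_bounded : exists C : R, forall p, `|U p| <= C)
    (U_borel : borel_fun U)
    (U_invariant : iso_invariant U) :
  exists phi : formula L, sentence phi /\
    forall (p : structure_space L) (A : structure L), codes (\val p) A ->
      forall v : nat -> A, U p = value phi v.
Proof.
have [C C0 UC] : exists2 C : R, 0 <= C & forall p, - C <= U p <= C.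
  have [C UC] := U_bounded; exists `|C| => // p.
  by rewrite -ler_norml (le_trans (UC p))// ler_norm.
have /choice[psi /all_and2[psiP psiU]] : forall q : R, exists psi : formula L,
    block_formula 0 0 0 psi /\
    forall (p : structure_space L) (A : structure L), codes (\val p) A ->
    forall v : nat -> A, (q < U p -> value psi v = 0) /\ (~ q < U p -> 1 <= value psi v).
  move=> q; have [||psi ? ?] := @value_invariant_definable R L [set p | q < U p].
  - apply: definable_borel => //.
    have := U_borel `]q, +oo[%classic (measurable_itv _); congr (<<s _ >> _).
    by apply/seteqP; split=> p /=; rewrite in_itv /= andbT.
  - move=> p p' A pA p'A /=; rewrite (U_invariant p p' A A)//.
    by exists id; split=> //; exists id.
  - by exists psi.
pose clamp q : R := Num.max (- C) (Num.min C q).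
have clampP q : - C <= clamp q <= C.
  rewrite /clamp le_max lexx /= ge_max ge_min lexx /= andbT; lra.
(* An affine interpolation: [clamp q] where psi is 0, and -C, the lower bound of U, where psi is at
   least 1. *)
pose f q (x : {ptws 'I_1 -> R}) : R :=
  clamp q + - (clamp q + C) * Num.min 1 (x ord0).
pose q_ n : R := ratr (odflt 0 (unpickle n)).
pose term q : formula L := Conn 1 (f q) (fun=> psi q).
exists (BigSup (block_modulus 0 0 0) [set` `[- C, C]] (fun n => term (q_ n))).
split.
  split; last first.
    rewrite -subset0 => i [n _ [_ _]]; have [_ psi_fv _] := psiP (q_ n).
    by move=> /psi_fv /andP[_]; rewrite addn0 ltn0.
  split; first by exists (- C), C; rewrite ge0_cp.
  - move=> n; split; first by move=> _; have [] := psiP (q_ n).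
    apply/continuous_subspaceT/continuous_realD; first exact: cst_continuous.
    apply: continuous_realM; first exact: cst_continuous.
    apply: continuous_real_min; first exact: cst_continuous.
    exact: continuous_coord.
  - move=> n; have [_ _ [psi_mod psi_bound]] := psiP (q_ n); split.
      move=> delta d0; apply: conn_modulus_le; first exact: modulus_ge0.
      move=> x y _ _ xy; suff xy0 : x ord0 = y ord0.
        by rewrite /f xy0 subrr normr0 modulus_ge0.
      apply/eqP; rewrite -subr_eq0 -normr_le0; apply: le_trans (xy ord0) _.
      by apply: le_trans (psi_mod _ d0) _; rewrite block_modulusE mul0r.
    move=> _ [x /(_ ord0)/psi_bound + <-]; rewrite /= !in_itv /= => /andP[x0 x1].
    have /andP[cl cr] := clampP (q_ n); rewrite /f (min_idPr x1).
    by apply/andP; split; nra.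
move=> p A pA v.
have termE q : value (term q) v = if q < U p then clamp q else - C.
  have [val0 val1] := psiU q p A pA v; rewrite /= /f; case: ifPn => [/val0->|/negP/val1].
    by rewrite (min_idPr ler01) mulr0 addr0.
  by move=> /min_idPl ->; lra.
pose u n := if q_ n < U p then clamp (q_ n) else - C.
rewrite -[value _ v]/(sup (range (fun n => value (term (q_ n)) v))).
have -> : (fun n => value (term (q_ n)) v) = u by apply/funext => n; exact: termE.
have /andP[Ul Ur] := UC p.
have uU : ubound (range u) (U p).
  move=> _ [n _ <-]; rewrite /u; case: ifPn => // qU.
  by rewrite /clamp ge_max Ul ge_min (ltW qU) orbT.
apply/eqP; rewrite eq_le ge_sup ?andbT//; last by exists (u 0%N), 0%N.
(* A rational q strictly between the supremum and U p satisfies q <= C, so its term has value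
   [clamp q] >= q, above the supremum. *)
rewrite leNgt; apply/negP => /rat_in_itvoo[q].
rewrite in_itv /= => /andP[Sq qU].
have : u (pickle q) <= sup (range u) by apply: ub_le_sup; [exists (U p)|exists (pickle q)].
rewrite /u /q_ pickleK /= qU leNgt => /negP; apply; apply: lt_le_trans Sq _.
by rewrite /clamp le_max le_min lexx andbT (le_trans (ltW qU) Ur) orbT.
Qed.
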